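(* Let $q$ be even and let $\mathcal{K}$ be a $k$-arc in $PG(2,q)$ with $k\le 10$. If there exists a non-linear blocking set of minimum size of the secants of $\mathcal{K}$, then $k=8$ and $\mathcal{K}$ is projectively equivalent to an arc of the form $\mathcal{K}_0\cup\varphi(\mathcal{K}_0)$, where $\mathcal{K}_0=\{(0,0,1),(0,1,1),(1,0,1),(1,1,1)\}$ and $\varphi$ is the homology $$\varphi:(X_1,X_2,X_3)\mapsto(\lambda X_1+a_1X_3,\ \lambda X_2+a_2X_3,\ X_3)$$ for some $\lambda,a_1,a_2\in\mathbb{F}_q$ with $\lambda\neq 0,1$ and $\{a_1,a_2,a_1+a_2\}\cap\{0,1,\lambda,\lambda+1\}=\emptyset$.
   Context: $PG(2,q)$ is the Desarguesian projective plane over $\mathbb{F}_q$, with homogeneous coordinates $(X_1,X_2,X_3)$. A $k$-arc is a set of $k$ points no three of which are collinear. A secant of an arc is a line containing two (distinct) points of it. A blocking set of the secants of a $k$-arc $\mathcal{K}$ is a point set $\mathcal{B}\subset PG(2,q)\setminus\mathcal{K}$ having non-empty intersection with each secant of $\mathcal{K}$; such a set always has at least $k-1$ points, and it is said to be of minimum size if it has exactly $k-1$ points. It is linear if it is contained in a line, and non-linear otherwise. Two point sets are projectively equivalent if some projectivity (linear collineation) of $PG(2,q)$ maps one onto the other. *)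

(* Defs.v *)
From HB Require Import structures.
From mathcomp Require Import all_boot all_order all_algebra.

Set Implicit Arguments.
Unset Strict Implicit.
Unset Printing Implicit Defensive.

Import GRing.Theory.
Local Open Scope ring_scope.

(* Over a finite field, {vspace vT} is a finite type, so that sets of points
   can be finite sets of subspaces. *)
Section FiniteVspace.
Import VectorInternalTheory.
Variables (F : finFieldType) (vT : vectType F).
HB.instance Definition _ := [Countable of {vspace vT} by <:].
HB.instance Definition _ := [Finite of {vspace vT} by <:].
End FiniteVspace.

Section ProjectivePlane.
Variable F : finFieldType.
Implicit Types (K B : {set {vspace 'rV[F]_3}}) (L U : {vspace 'rV[F]_3}).

(* The points of PG(2,q) are the 1-dimensional subspaces of F_q^3, its lines
   are the 2-dimensional ones, and incidence is inclusion of subspaces. *)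
Definition PG2 : {set {vspace 'rV[F]_3}} := [set U | \dim U == 1%N].

Definition is_line L : Prop := \dim L = 2%N.

Definition collinear B : Prop :=
  exists L, is_line L /\ forall P, P \in B -> (P <= L)%VS.

Definition is_arc (k : nat) K : Prop :=
  [/\ K \subset PG2, #|K| = k &
      forall P Q R, P \in K -> Q \in K -> R \in K ->
        P != Q -> Q != R -> P != R -> ~ collinear [set P; Q; R]].

Definition secant K L : Prop :=
  is_line L /\
  exists P Q, [/\ P \in K, Q \in K, P != Q, (P <= L)%VS & (Q <= L)%VS].

Definition blocks_secants K B : Prop :=
  B \subset PG2 :\: K /\
  forall L, secant K L -> exists2 P, P \in B & (P <= L)%VS.

(* A projectivity is induced by an injective, hence bijective, linear
   endomorphism of F_q^3. *)
Definition proj_image (f : 'End('rV[F]_3)) K : {set {vspace 'rV[F]_3}} :=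
  [set (f @: P)%VS | P in K].

Definition proj_equiv K1 K2 : Prop :=
  exists f : 'End('rV[F]_3), (lker f == 0)%VS /\ proj_image f K1 = K2.

Definition vec3 (x1 x2 x3 : F) : 'rV[F]_3 := \row_(i < 3) [:: x1; x2; x3]`_i.

Definition pt (x1 x2 x3 : F) : {vspace 'rV[F]_3} := <[vec3 x1 x2 x3]>%VS.

Definition arc0 : {set {vspace 'rV[F]_3}} :=
  [set pt 0 0 1; pt 0 1 1; pt 1 0 1; pt 1 1 1].

(* [linfun] is only meaningful on linear functions; see [homologyE]. *)
Definition homology (lam a1 a2 : F) : 'End('rV[F]_3) :=
  linfun (fun v : 'rV[F]_3 =>
    vec3 (lam * v 0 0 + a1 * v 0 2) (lam * v 0 1 + a2 * v 0 2) (v 0 2)).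

Lemma homologyE (lam a1 a2 x1 x2 x3 : F) :
  homology lam a1 a2 (vec3 x1 x2 x3) =
  vec3 (lam * x1 + a1 * x3) (lam * x2 + a2 * x3) x3.
Proof.
pose g (v : 'rV[F]_3) :=
  vec3 (lam * v 0 0 + a1 * v 0 2) (lam * v 0 1 + a2 * v 0 2) (v 0 2).
have g_lin : linear g.
  move=> c u v; apply/rowP => i; rewrite !mxE.
  case: i => [[|[|[|//]]] ltk3] /=;
    by rewrite ?mulrDr ?(mulrCA _ c) 1?addrACA.
pose gL := HB.pack_for {linear 'rV[F]_3 -> 'rV[F]_3} g
  (GRing.isLinear.Build _ _ _ _ g g_lin).
by rewrite (lfunE gL) /= /g !mxE.
Qed.

End ProjectivePlane.

(* Main.v *)
(** Write each point P of the arc K as <v_P>.  Since |B| = k - 1, for every P in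
    K the lines joining P to the points of B are exactly the secants through P,
    so each secant PQ carries exactly one point b_PQ of B.  The representatives
    can be rescaled so that v_P + v_Q spans b_PQ for all P, Q: if
    b_PQ = x_QP u_P + x_PQ u_Q, divide u_P by the product of the x_PQ over Q.
    Hence, in characteristic 2, for a line L = ker phi joining two points of B,
    b_PQ lies on L exactly when phi v_P = phi v_Q.  The level classes of
    phi v on K therefore all have m + 1 elements, where m >= 2 is the number of
    points of B on L; m + 1 is even, because a point of B on L pairs up each
    class, and it is a proper divisor of k when B is non-linear.  With k <= 10
    this forces k = 8 and m = 3.  Each of the two classes is then a quadruple
    with v_1 + v_2 + v_3 + v_4 = 0, and the points of B off L show that the
    second one is the translate v_i + d of the first.  Coordinates in which the
    first quadruple is K_0 give the theorem, with lambda = 1 / (1 + d_3) and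
    a_i = d_i / (1 + d_3). *)

Require Import Defs.
From mathcomp Require Import all_boot all_order all_algebra all_field.
From mathcomp Require Import zify.

Set Implicit Arguments.
Unset Strict Implicit.
Unset Printing Implicit Defensive.

Import GRing.Theory.
Local Open Scope ring_scope.

(** * Characteristic 2 and the linear algebra of points, lines and functionals *)

Lemma even_pchar2 (F : finFieldType) : ~~ odd #|F| -> 2%N \in [pchar F].
Proof.
move=> evF; have [p p_pr pF] := finPcharP F.
suff -> : 2%N = p by [].
have := card_pprimeChar pF; case: (posnP (logn p #|F|)) => [-> /= F1|n0 cF].
  by have := finNzRing_gt1 F; rewrite F1.
have : (2 %| #|F|)%N by rewrite dvdn2.
by rewrite cF Euclid_dvdX // dvdn_prime2 // => /andP[/eqP].
Qed.

Lemma oppv_pchar2 (F : nzRingType) (V : lmodType F) (v : V) :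
  2%N \in [pchar F] -> - v = v.
Proof. by move=> F2; rewrite -scaleN1r oppr_pchar2 // scale1r. Qed.

Section Subspaces.
Variables (F : finFieldType) (vT : vectType F).
Implicit Types (U L P Q : {vspace vT}).

Lemma dim1_vline U : \dim U = 1%N -> U = <[vpick U]>%VS.
Proof.
move=> dU; apply/eqP; rewrite eq_sym eqEdim -memvE memv_pick dU dim_vline
  vpick0.
by rewrite -dimv_eq0 dU.
Qed.

Lemma dim1_sub_eq P Q : \dim P = 1%N -> \dim Q = 1%N -> (P <= Q)%VS -> P = Q.
Proof. by move=> dP dQ sPQ; apply/eqP; rewrite eqEdim sPQ dP dQ. Qed.

Lemma dimv_add2 P Q :
  \dim P = 1%N -> \dim Q = 1%N -> P != Q -> \dim (P + Q) = 2%N.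
Proof.
move=> dP dQ nPQ; rewrite dimv_disjoint_sum ?dP ?dQ //.
apply/eqP; rewrite -dimv_eq0; apply/negPn/negP => n0; case/negP: nPQ.
have dI : \dim (P :&: Q) = 1%N.
  by apply/eqP; rewrite eqn_leq lt0n n0 -dP dimvS ?capvSl.
by rewrite -(dim1_sub_eq dI dP (capvSl _ _)) -{2}(dim1_sub_eq dI dQ (capvSr _
  _)).
Qed.

Lemma addv_eq_line P Q L : \dim P = 1%N -> \dim Q = 1%N -> P != Q ->
  \dim L = 2%N -> (P <= L)%VS -> (Q <= L)%VS -> (P + Q)%VS = L.
Proof.
move=> dP dQ nPQ dL PL QL; apply/eqP.
by rewrite eqEdim subv_add PL QL dL dimv_add2.
Qed.

(** A basis of [U] followed by a basis of a complement, cut after [n] vectors, still contains the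
    basis of [U]. *)
Lemma sub_dimv_eq n U : (\dim U <= n <= \dim {:vT})%N ->
  exists2 L, \dim L = n & (U <= L)%VS.
Proof.
case/andP=> Un nV; pose X := vbasis U ++ vbasis U^C.
have fX : free X.
  rewrite cat_free !(basis_free (vbasisP _)) !(span_basis (vbasisP _)).
  by rewrite directvEgeq /= dimv_disjoint_sum ?capv_compl //.
have sX : <<X>>%VS = fullv.
  by rewrite span_cat !(span_basis (vbasisP _)) addv_complf.
exists <<take n X>>%VS.
  have : free (take n X ++ drop n X) by rewrite cat_take_drop.
  move/catl_free => /eqP ->; rewrite size_takel //.
  by move: fX => /eqP <-; rewrite sX.
rewrite -{1}(span_basis (vbasisP U)); apply: sub_span => v vU.
by rewrite take_cat size_tuple ltnNge Un /= mem_cat vU.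
Qed.

(** The map [\1 - projv L] has kernel [L], hence an image of dimension 1; its coordinate along a
    generator of the image is the functional. *)
Lemma hyperplane_functional L : (\dim L).+1 = \dim {:vT} ->
  exists phi : {linear vT -> F^o}, forall x, (phi x == 0) = (x \in L).
Proof.
move=> dL; pose f := (\1 - projv L)%VF.
have kf x : (f x == 0) = (x \in L).
  rewrite add_lfunE opp_lfunE id_lfunE subr_eq0.
  apply/eqP/idP => [->|xL]; first exact: memv_proj.
  by rewrite projv_id.
have kfE : lker f = L by apply/vspaceP => x; rewrite memv_ker kf.
have dI : \dim (limg f) = 1%N.
  by have := limg_ker_dim f fullv; rewrite capfv kfE -dL -addn1 => /addnI.
pose z := vpick (limg f).
have z0 : z != 0 by rewrite vpick0 -dimv_eq0 dI.
exists (coord [tuple z] ord0 \o f) => x /=; rewrite -kf.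
have : f x \in limg f by rewrite memv_img ?memvf.
rewrite (dim1_vline dI) -/z -span_seq1 => /(@coord_span _ _ _ [tuple z]).
rewrite big_ord1 /= => {2}->.
by rewrite scaler_eq0 (negPf z0) orbF.
Qed.

End Subspaces.

(** * Counting in finite sets *)

Lemma dvdn_card_fibers (T : finType) (T' : eqType) (f : T -> T')
    (A : {set T}) n :
  (forall x, x \in A -> #|[set y in A | f y == f x]| = n) -> (n %| #|A|)%N.
Proof.
move=> fibA; rewrite (card_partition (preim_partitionP f A)).
apply: dvdn_sum => _ /imsetP[x xA ->].
rewrite (_ : #|_| = n) // -(fibA x xA).
by apply: eq_card => y; rewrite !inE eq_sym.
Qed.

Lemma cards4P (T : finType) (A : {set T}) : #|A| = 4 ->
  exists a b c d, uniq [:: a; b; c; d] /\ A = [set a; b; c; d].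
Proof.
rewrite cardE => A4; have := enum_uniq A; have := mem_enum A; move: A4.
case: (enum A) => [|a [|b [|c [|d [|]]]]] // _ memA uA.
exists a, b, c, d; split=> //; apply/setP => x.
by rewrite -memA !inE -!orbA.
Qed.

(** * Coordinates in F^3 and frames *)

Section Coordinates.
Variable F : finFieldType.
Implicit Types (x y z s t lam : F) (u v w d p : 'rV[F]_3).

Lemma vec3D x y z x' y' z' :
  vec3 x y z + vec3 x' y' z' = vec3 (x + x') (y + y') (z + z').
Proof. by apply/rowP => -[[|[|[|//]]] i3]; rewrite !mxE. Qed.

Lemma vec3Z t x y z : t *: vec3 x y z = vec3 (t * x) (t * y) (t * z).
Proof. by apply/rowP => -[[|[|[|//]]] i3]; rewrite !mxE. Qed.

Lemma vec3_inj x y z x' y' z' :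
  vec3 x y z = vec3 x' y' z' -> [/\ x = x', y = y' & z = z'].
Proof.
by move/rowP=> e; split; [move: (e 0) | move: (e 1) | move: (e 2)];
  rewrite !mxE.
Qed.

Lemma vec3_0 : vec3 0 0 0 = 0 :> 'rV[F]_3.
Proof. by apply/rowP => -[[|[|[|//]]] i3]; rewrite !mxE. Qed.

Lemma vline_scale t v : t != 0 -> <[t *: v]>%VS = <[v]>%VS.
Proof.
move=> t0; apply/eqP; rewrite eqEsubv -!memvE rpredZ ?memv_line //=.
by apply/vlineP; exists t^-1; rewrite scalerA mulVf ?scale1r.
Qed.

Lemma free3_coords p1 p2 p3 : free [:: p1; p2; p3] ->
  forall v, exists x y z, v = x *: p1 + y *: p2 + z *: p3.
Proof.
move=> fp v; have bp : basis_of fullv [tuple p1; p2; p3].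
  by rewrite basisEfree fp subvf dimvf.
have := coord_basis bp (memvf v);
  rewrite !big_ord_recl big_ord0 addr0 addrA => ->.
by do 3 eexists.
Qed.

(** The targets are the first three points of K_0. In characteristic 2 their sum is [vec3 1 1 1], so
    [p1 + p2 + p3] goes to the fourth. *)
Lemma free3_frame p1 p2 p3 : free [:: p1; p2; p3] -> 2%N \in [pchar F] ->
  exists f : 'End('rV[F]_3),
    [/\ (lker f == 0)%VS, f p1 = vec3 0 0 1,
      f p2 = vec3 0 1 1 & f p3 = vec3 1 0 1].
Proof.
move=> fp F2.
have [f0 /(_ fp erefl)] := linear_of_free [:: p1; p2; p3]
  [:: vec3 0 0 1; vec3 0 1 1; vec3 1 0 1 : 'rV[F]_3].
case=> f1 f2 f3; exists (linfun f0); rewrite !lfunE; split=> //.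
rewrite -subv0; apply/subvP => v; rewrite memv_ker memv0 lfunE /=.
have [x [y [z ->]]] := free3_coords fp v.
rewrite !linearD !linearZ /= f1 f2 f3 !vec3Z !vec3D -vec3_0.
move/eqP/vec3_inj; rewrite !mulr0 !mulr1 !addr0 !add0r => -[-> ->].
by rewrite !addr0 => ->; rewrite !scale0r !addr0 vec3_0.
Qed.

(** * A quadruple with zero sum and its translate by a vector *)

Section TranslatedQuads.
Variables (p1 p2 p3 d : 'rV[F]_3) (phi : {linear 'rV[F]_3 -> F^o}).
Let ps := [:: p1; p2; p3; p1 + p2 + p3].
Hypotheses (pchar2 : 2%N \in [pchar F]) (freep : free [:: p1; p2; p3]).
Hypotheses (phi12 : phi p2 = phi p1) (phi13 : phi p3 = phi p1).
Hypotheses (phid : phi d != 0) (phidp : phi d != phi p1).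
Hypothesis noncollinear : forall u v w, u \in ps -> v \in ps -> w \in ps ->
  u != v -> w + d \notin (<[u]> + <[v]>)%VS.

Let addFF x : x + x = 0. Proof. exact: addrr_pchar2. Qed.
Let addF_eq0 x y : (x + y == 0) = (x == y).
Proof. by rewrite addr_eq0 oppr_pchar2. Qed.
Let addFK x y : x + (x + y) = y. Proof. by rewrite addrA addFF add0r. Qed.

Section Frame.
Variable f : 'End('rV[F]_3).
Hypotheses (f_inj : (lker f == 0)%VS) (f1 : f p1 = vec3 0 0 1).
Hypotheses (f2 : f p2 = vec3 0 1 1) (f3 : f p3 = vec3 1 0 1).

Let f4 : f (p1 + p2 + p3) = vec3 1 1 1.
Proof. by rewrite !linearD /= f1 f2 f3 !vec3D !addr0 !add0r addFF add0r. Qed.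

Lemma frame_noncollinear u v w s t : u \in ps -> v \in ps -> w \in ps ->
  f u != f v -> f (w + d) != s *: f u + t *: f v.
Proof.
move=> ups vps wps nuv; apply/eqP; rewrite -!linearZ -linearD.
move/(lker0P f_inj) => e; have : u != v by apply: contraNneq nuv => ->.
by move/(noncollinear ups vps wps)/negP; apply;
  rewrite e memv_add ?rpredZ ?memv_line.
Qed.

(** The six inequalities negate the equations of the six secants of K_0. *)
Lemma frame_off_secants w X Y Z : w \in ps -> f (w + d) = vec3 X Y Z ->
  [/\ X != 0, X != Z, Y != 0 & Y != Z] /\ (X != Y /\ X + Y != Z).
Proof.
move=> wps e.
have nc u v (ups : u \in ps) (vps : v \in ps) s t :
  f u != f v -> f (w + d) != s *: f u + t *: f v by exact: frame_noncollinear.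
have m1 : p1 \in ps by rewrite !inE eqxx.
have m2 : p2 \in ps by rewrite !inE eqxx orbT.
have m3 : p3 \in ps by rewrite !inE eqxx !orbT.
have m4 : p1 + p2 + p3 \in ps by rewrite !inE eqxx !orbT.
have ne x y z x' y' z' : [|| x != x', y != y' | z != z'] ->
    vec3 x y z != vec3 x' y' z'.
  by apply: contraTneq => /vec3_inj[-> -> ->]; rewrite !eqxx.
have n01 : (0 : F) != 1 by rewrite eq_sym oner_eq0.
(* In each case the coefficients are those that would express (X, Y, Z) through the two points if it
   satisfied the equation of their secant; here the equation is X = 0. *)
have := nc _ _ m1 m2 (Z + Y) Y; rewrite f1 f2 ne ?n01 ?orbT // => /(_ isT).
have := nc _ _ m3 m4 (Z + Y) Y; rewrite f3 f4 ne ?n01 ?orbT // => /(_ isT).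
have := nc _ _ m1 m3 (Z + X) X; rewrite f1 f3 ne ?n01 ?orbT // => /(_ isT).
have := nc _ _ m2 m4 (Z + X) X; rewrite f2 f4 ne ?n01 ?orbT // => /(_ isT).
have := nc _ _ m1 m4 (Z + X) X; rewrite f1 f4 ne ?n01 ?orbT // => /(_ isT).
have := nc _ _ m2 m3 Y X; rewrite f2 f3 ne ?n01 ?orbT // => /(_ isT).
rewrite e !vec3Z !vec3D !mulr0 !mulr1 !addr0 !add0r.
have ZK x : Z + x + x = Z by rewrite -addrA addFF addr0.
rewrite !ZK => n6 n5 n4 n3 n2 n1.
do !split; [move: n1 | move: n2 | move: n3 | move: n4 | move: n5 | ];
  last by apply: contraNneq n6 => <-; rewrite addrC.
all: by apply: contraNneq => ->.
Qed.

End Frame.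

(** In the frame, a translated point is (x + d1, y + d2, 1 + h). Dividing by [c = 1 + h] shows it as
    the image of (x, y, 1) under the homology with ratio 1 / c and a_i = d_i / c. *)
Lemma translated_quads_equiv (K : {set {vspace 'rV[F]_3}}) :
    K = [set <[p1]>; <[p2]>; <[p3]>; <[p1 + p2 + p3]>]%VS :|:
        [set <[p1 + d]>; <[p2 + d]>; <[p3 + d]>; <[p1 + p2 + p3 + d]>]%VS ->
  exists lam a1 a2 : F,
    [/\ lam != 0, lam != 1,
        [set a1; a2; a1 + a2] :&: [set (0 : F); (1 : F); lam; lam + 1] = set0 &
        proj_equiv K (arc0 F :|: proj_image (homology lam a1 a2) (arc0 F))].
Proof.
move=> defK; have [f [f_inj f1 f2 f3]] := free3_frame freep pchar2.
(* The coefficients are named so that the first two coordinates of [f d] are [d1] and [d2]. *)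
have [d3 [d2 [d1 ed]]] := free3_coords freep d.
pose h := d3 + d2 + d1; pose c := 1 + h.
have fd : f d = vec3 d1 d2 h.
  rewrite ed !linearD !linearZ /= f1 f2 f3 !vec3Z !vec3D.
  by rewrite !mulr0 !mulr1 !addr0 !add0r.
(* Since [phi] takes one value on [p1], [p2], [p3], [phid] yields [h != 0], hence [lam != 1], and
   [phidp] yields [h != 1], hence [c != 0]. *)
have phidE : phi d = h *: phi p1.
  by rewrite ed !linearD !linearZ /= phi12 phi13 -!scalerDl.
have h0 : h != 0 by apply: contraNneq phid => h0; rewrite phidE h0 scale0r.
have c0 : c != 0.
  rewrite addF_eq0 eq_sym; apply: contraNneq phidp => h1.
  by rewrite phidE h1 scale1r.
have c1 : c != 1 by rewrite -subr_eq0 /c addrC addKr.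
have off w X Y : w \in ps -> f w = vec3 X Y 1 ->
    [/\ X + d1 != 0, X + d1 != c, Y + d2 != 0 & Y + d2 != c] /\
    (X + d1 != Y + d2 /\ (X + d1) + (Y + d2) != c).
  move=> wps fw; apply: (frame_off_secants f_inj f1 f2 f3 wps).
  by rewrite linearD /= fw fd vec3D.
have m2 : p2 \in ps by rewrite !inE eqxx orbT.
have m3 : p3 \in ps by rewrite !inE eqxx !orbT.
(* Together [p1 + d], [p2 + d], [p3 + d] keep [d1], [d2] and [d1 + d2] away from [0], [c], [1] and
   [1 + c], which become [0], [1], [lam] and [lam + 1] after division by [c]. *)
have [[]] := off _ _ _ (mem_head _ _) f1; rewrite !add0r =>
  x0 xc y0 yc [xy0 xyc].
have [[]] := off _ _ _ m2 f2; rewrite !add0r => _ _ y1 yc1 [xy1 xyc1].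
have [[]] := off _ _ _ m3 f3; rewrite !add0r => x1 xc1 _ _ _.
pose hom := homology c^-1 (d1 / c) (d2 / c).
have hom_pt x y :
    (hom @: pt x y 1%R)%VS = <[(vec3 x y 1 + vec3 d1 d2 h)%R]>%VS.
  rewrite /pt limg_line homologyE -[RHS](@vline_scale c^-1) ?invr_eq0 //.
  by rewrite vec3D vec3Z -/c mulVf // !mulr1 -![_ / c]mulrC -!mulrDr.
exists c^-1, (d1 / c), (d2 / c); split.
- by rewrite invr_eq0.
- by rewrite invr_eq1.
- have avoid x : x != 0 -> x != c -> 1 + x != 0 -> 1 + x != c ->
      x / c \notin [set (0 : F); (1 : F); c^-1; c^-1 + 1].
    move=> n0 nc n1 nc1; rewrite !inE -!orbA; apply/negP.
    case/or4P=> /eqP e; have := divfK c0 x; rewrite e.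
    - by rewrite mul0r => x_eq; rewrite -x_eq eqxx in n0.
    - by rewrite mul1r => x_eq; rewrite -x_eq eqxx in nc.
    - by rewrite mulVf // => x_eq; rewrite -x_eq addFF eqxx in n1.
    - rewrite mulrDl mulVf // mul1r => x_eq.
      by rewrite -x_eq addFK eqxx in nc1.
  have dd : d1 / c + d2 / c = (d1 + d2) / c by rewrite mulrDl.
  apply/setP => x; rewrite in_setI dd [RHS]inE; apply/negP => /andP[].
  rewrite in_setU in_setU !in_set1 -orbA.
  case/or3P=> /eqP->; apply/negP; apply: avoid => //.
  + by rewrite addF_eq0.
  + by rewrite addrCA addF_eq0.
  + by rewrite addrCA.
exists f; split=> //; rewrite defK /proj_image imsetU !imsetU !imset_set1.
rewrite -/hom !hom_pt !limg_line !linearD /= f1 f2 f3 fd.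
have -> : vec3 0 0 1 + vec3 0 1 1 + vec3 1 0 1 = vec3 1 1 1 :> 'rV[F]_3.
  by rewrite !vec3D !addr0 !add0r addFF add0r.
by rewrite /arc0 /pt.
Qed.

End TranslatedQuads.

End Coordinates.

(** * Secants through a point of the arc and their blocking points *)

Section MinimumBlockingSet.
Variables (F : finFieldType) (k : nat) (K B : {set {vspace 'rV[F]_3}}).
Hypotheses (arcK : is_arc k K) (blockB : blocks_secants K B).
Hypothesis cardB : #|B| = (k - 1)%N.
Implicit Types (P Q R beta : {vspace 'rV[F]_3}).

Lemma dim_arc P : P \in K -> \dim P = 1%N.
Proof. by case: arcK => /subsetP sK _ _ /sK; rewrite inE => /eqP. Qed.

Lemma blocking_point beta : beta \in B -> \dim beta = 1%N /\ beta \notin K.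
Proof.
by case: blockB => /subsetP sB _ /sB; rewrite !inE => /andP[nK /eqP].
Qed.

Lemma blocking_neq P beta : P \in K -> beta \in B -> P != beta.
Proof. by move=> PK /blocking_point[_]; apply: contraNneq => <-. Qed.

Lemma arc_noncollinear P Q R : P \in K -> Q \in K -> R \in K ->
  P != Q -> R != P -> R != Q -> ~~ (R <= P + Q)%VS.
Proof.
case: arcK => _ _ arc PK QK RK nPQ nRP nRQ; apply/negP => sR.
rewrite eq_sym in nRP; rewrite eq_sym in nRQ.
apply: (arc P Q R) => //; exists (P + Q)%VS; split.
  by rewrite /is_line dimv_add2 ?dim_arc.
move=> S; rewrite !inE => /orP[/orP[] | ] /eqP-> //.
  exact: addvSl.
exact: addvSr.
Qed.

(** The point b_PQ. The choice depends on [P + Q] only, which makes it symmetric; the default [0] is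
    never returned for distinct points of [K]. *)
Definition block_pt P Q := odflt 0%VS [pick beta in B | (beta <= P + Q)%VS].

Lemma block_ptP P Q : P \in K -> Q \in K -> P != Q ->
  block_pt P Q \in B /\ (block_pt P Q <= P + Q)%VS.
Proof.
move=> PK QK nPQ; rewrite /block_pt; case: pickP => [beta /andP[] // | none].
case: blockB => _ /(_ (P + Q)%VS)[|beta bB sb]; last first.
  by have := none beta; rewrite bB sb.
split; first by rewrite /is_line dimv_add2 ?dim_arc.
by exists P, Q; rewrite addvSl addvSr.
Qed.

Lemma block_ptC P Q : block_pt P Q = block_pt Q P.
Proof. by rewrite /block_pt addvC. Qed.

Lemma secant_blockE P Q beta : P \in K -> Q \in K -> P != Q -> beta \in B ->
  (beta <= P + Q)%VS -> (P + beta)%VS = (P + Q)%VS.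
Proof.
move=> PK QK nPQ bB sb; have [db _] := blocking_point bB.
apply: addv_eq_line => //; rewrite ?addvSl ?blocking_neq //.
  exact: dim_arc.
by rewrite dimv_add2 ?dim_arc.
Qed.

(** Both secants equal [P + beta], so [Q] and [R] distinct would give three collinear points of the
    arc. *)
Lemma secant_uniq P Q R beta : P \in K -> Q \in K -> R \in K ->
  Q != P -> R != P -> beta \in B ->
  (beta <= P + Q)%VS -> (beta <= P + R)%VS -> Q = R.
Proof.
move=> PK QK RK nQP nRP bB sQ sR; apply/eqP/idPn => nQR.
have nPQ : P != Q by rewrite eq_sym.
have nPR : P != R by rewrite eq_sym.
have /negP[] : ~~ (R <= P + Q)%VS by apply: arc_noncollinear; rewrite // eq_sym.
by rewrite -(secant_blockE PK QK nPQ bB sQ) (secant_blockE PK RK nPR) ?addvSr.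
Qed.

Lemma block_pt_inj P : P \in K -> {in K :\ P &, injective (block_pt P)}.
Proof.
move=> PK Q R; rewrite !inE => /andP[nQ QK] /andP[nR RK] eqQR.
have nPQ : P != Q by rewrite eq_sym.
have nPR : P != R by rewrite eq_sym.
have [bB sQ] := block_ptP PK QK nPQ; have [_ sR] := block_ptP PK RK nPR.
by apply: (secant_uniq PK QK RK nQ nR bB); rewrite // eqQR.
Qed.

Lemma block_ptI P Q R : P \in K -> Q \in K -> R \in K -> P != Q -> P != R ->
  block_pt P Q = block_pt P R -> Q = R.
Proof.
by move=> PK QK RK nPQ nPR; apply: block_pt_inj PK _ _ _ _;
  rewrite !inE eq_sym ?nPQ ?nPR.
Qed.

(** Minimality enters here: an injection of the k - 1 points of [K :\ P] into the k - 1 points of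
    [B] is onto. *)
Lemma block_pt_imset P : P \in K -> block_pt P @: (K :\ P) = B.
Proof.
move=> PK; apply/eqP; rewrite eqEcard card_in_imset; last exact: block_pt_inj.
case: arcK => _ cK _; apply/andP; split.
  apply/subsetP => _ /imsetP[Q + ->]; rewrite !inE => /andP[nQ QK].
  by have [] := block_ptP PK QK; first by rewrite eq_sym.
by have := cardsD1 P K; rewrite PK cK cardB => ->; rewrite add1n subn1.
Qed.

Lemma block_partner P beta : P \in K -> beta \in B ->
  exists2 Q, (Q \in K) && (Q != P) & beta = block_pt P Q.
Proof.
move=> PK; rewrite -{1}(block_pt_imset PK) => /imsetP[Q].
by rewrite !inE => /andP[nQ QK] ->; exists Q; rewrite ?QK.
Qed.

(** * Rescaling the representatives of the arc points *)

(** This is x_PQ for u = [vpick]: the coordinate of b_PQ along the second argument [Q]. *)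
Definition block_coef P Q : F :=
  odflt 0 [pick y | vpick (block_pt P Q) - y *: vpick Q \in P].

Lemma block_coef_uniq P Q y : P \in K -> Q \in K -> P != Q ->
  vpick (block_pt P Q) - y *: vpick Q \in P -> block_coef P Q = y.
Proof.
move=> PK QK nPQ yP; rewrite /block_coef; case: pickP => [z zP /=|/(_ y)];
  last by rewrite yP.
apply/eqP; rewrite -subr_eq0; apply/idPn => nzy.
have : (z - y) *: vpick Q \in P.
  by have := rpredB yP zP; rewrite opprB addrC addrA subrK -scalerBl.
rewrite rpredZeq (negPf nzy) /= memvE -(dim1_vline (dim_arc QK)) => sQP.
by case/eqP: nPQ; apply/esym/dim1_sub_eq; rewrite ?dim_arc.
Qed.

Lemma block_coefE P Q : P \in K -> Q \in K -> P != Q ->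
  vpick (block_pt P Q) =
    block_coef Q P *: vpick P + block_coef P Q *: vpick Q.
Proof.
move=> PK QK nPQ; have [_ sb] := block_ptP PK QK nPQ.
have := subvP sb _ (memv_pick _) => /memv_addP[a + [b + eb]].
rewrite {1}(dim1_vline (dim_arc PK)) => /vlineP[x ea].
rewrite {1}(dim1_vline (dim_arc QK)) => /vlineP[y eb'].
rewrite (@block_coef_uniq P Q y) ?(@block_coef_uniq Q P x) -?ea -?eb' //.
- by rewrite eq_sym.
- by rewrite block_ptC eb addrC addKr -?ea eb' rpredZ ?memv_pick.
- by rewrite eb addrK ea rpredZ ?memv_pick.
Qed.

Lemma block_coef_neq0 P Q : P \in K -> Q \in K -> P != Q ->
  block_coef P Q != 0.
Proof.
move=> PK QK nPQ; apply/eqP => c0; have [bB _] := block_ptP PK QK nPQ.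
have [db nbK] := blocking_point bB.
case/negP: nbK; rewrite (_ : block_pt P Q = P) //.
apply: (dim1_sub_eq db (dim_arc PK)); rewrite (dim1_vline db) -memvE.
by rewrite block_coefE // c0 scale0r addr0 rpredZ ?memv_pick.
Qed.

(** The points of [B] other than b_PQ are the b_PR with R distinct from P and Q, and [phi] kills the
    component of b_PR along P. *)
Lemma prod_block_functional (phi : {linear 'rV[F]_3 -> F^o}) P Q :
  P \in K -> Q \in K -> P != Q -> phi (vpick P) = 0 ->
  \prod_(gamma in B :\ block_pt P Q) phi (vpick gamma) =
  (\prod_(R in K :\ P :\ Q) block_coef P R) *
  (\prod_(R in K :\ P :\ Q) (phi (vpick R) : F)).
Proof.
move=> PK QK nPQ phiP.
have QKP : Q \in K :\ P by rewrite !inE eq_sym nPQ.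
have inj : {in K :\ P :\ Q &, injective (block_pt P)}.
  by apply: sub_in2 (block_pt_inj PK) => R /setD1P[].
have <- : block_pt P @: (K :\ P :\ Q) = B :\ block_pt P Q.
  apply/setP => beta; rewrite -(block_pt_imset PK) !inE.
  apply/imsetP/andP => [[R /setD1P[nRQ RK] ->] | [nb /imsetP[R RK eb]]].
    split; last exact: imset_f.
    by apply: contra nRQ => /eqP e; apply/eqP; apply: block_pt_inj e.
  by exists R => //; rewrite in_setD1 RK andbT; apply: contraNneq nb => <-;
    rewrite eb.
rewrite big_imset //= -big_split; apply: eq_bigr => R.
rewrite !inE => /and3P[_ nRP RK]; rewrite block_coefE // 1?eq_sym //.
by rewrite linearD !linearZ /= phiP scaler0 add0r.
Qed.

Definition arc_weight P := \prod_(Q in K :\ P) block_coef P Q.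

(* Both sides of the identity arise from evaluating, at a functional vanishing
   on the secant PQ only, the product of the points of B off PQ: each of them
   lies on a line PR and on a line QR'. *)
Lemma arc_weight_swap P Q : P \in K -> Q \in K -> P != Q ->
  arc_weight P * block_coef Q P = arc_weight Q * block_coef P Q.
Proof.
move=> PK QK nPQ; have nQP : Q != P by rewrite eq_sym.
have dPQ : \dim (P + Q) = 2%N by rewrite dimv_add2 ?dim_arc.
have [|phi phiE] := @hyperplane_functional _ _ (P + Q)%VS.
  by rewrite dPQ dimvf.
have phiP : phi (vpick P) = 0.
  by apply/eqP; rewrite phiE (subvP (addvSl _ _)) ?memv_pick.
have phiQ : phi (vpick Q) = 0.
  by apply/eqP; rewrite phiE (subvP (addvSr _ _)) ?memv_pick.
have nz : \prod_(R in K :\ P :\ Q) (phi (vpick R) : F) != 0.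
  apply/prodf_neq0 => R; rewrite !inE => /and3P[nRQ nRP RK].
  rewrite phiE memvE -(dim1_vline (dim_arc RK)).
  exact: arc_noncollinear.
have KQP : K :\ Q :\ P = K :\ P :\ Q by rewrite !setDDl setUC.
have := prod_block_functional PK QK nPQ phiP.
rewrite block_ptC (prod_block_functional QK PK nQP phiQ) KQP => /(mulIf nz) e.
(* The equal products over R distinct from P and Q lack only the factors x_PQ and x_QP, so both
   sides are that product times x_PQ x_QP. *)
rewrite /arc_weight (big_setD1 Q) ?inE ?nQP //= -e.
rewrite (@big_setD1 _ _ _ _ P (K :\ Q)) ?inE ?nPQ //= KQP.
by rewrite mulrC mulrCA mulrC -!mulrA; congr (_ * _); apply: mulrC.
Qed.

Lemma arc_weight_neq0 P : P \in K -> arc_weight P != 0.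
Proof.
move=> PK; apply/prodf_neq0 => Q; rewrite !inE => /andP[nQ QK].
by apply: block_coef_neq0; rewrite // eq_sym.
Qed.

Definition arc_rep P : 'rV[F]_3 := (arc_weight P)^-1 *: vpick P.

Lemma arc_repE P : P \in K -> P = <[arc_rep P]>%VS.
Proof.
move=> PK; rewrite {1}(dim1_vline (dim_arc PK)); apply/eqP.
rewrite eqEsubv -!memvE rpredZ ?memv_line // andbT.
apply/vlineP; exists (arc_weight P).
by rewrite scalerA mulfV ?arc_weight_neq0 ?scale1r.
Qed.

(** By [arc_weight_swap], one scalar turns both terms of x_QP u_P + x_PQ u_Q into the rescaled
    representatives. *)
Lemma arc_rep_add P Q : P \in K -> Q \in K -> P != Q ->
  arc_rep P + arc_rep Q \in block_pt P Q.
Proof.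
move=> PK QK nPQ; have nQP : Q != P by rewrite eq_sym.
have cP := arc_weight_neq0 PK; have cQ := arc_weight_neq0 QK.
have kPQ := block_coef_neq0 PK QK nPQ.
suff -> : arc_rep P + arc_rep Q =
    (arc_weight Q * block_coef P Q)^-1 *: vpick (block_pt P Q).
  by rewrite rpredZ ?memv_pick.
rewrite block_coefE // scalerDr !scalerA; congr (_ *: _ + _ *: _); last first.
  by rewrite invfM mulfVK.
by rewrite -arc_weight_swap // invfM mulfVK ?block_coef_neq0.
Qed.

Lemma arc_rep_inj : {in K &, injective arc_rep}.
Proof. by move=> P Q PK QK e; rewrite (arc_repE PK) (arc_repE QK) e. Qed.

Hypothesis pchar2 : 2%N \in [pchar F].

Lemma arc_rep_addE P Q : P \in K -> Q \in K -> P != Q ->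
  block_pt P Q = <[arc_rep P + arc_rep Q]>%VS.
Proof.
move=> PK QK nPQ; have [/blocking_point[db _] _] := block_ptP PK QK nPQ.
apply/esym/dim1_sub_eq => //; last by rewrite -memvE arc_rep_add.
rewrite dim_vline addr_eq0 oppv_pchar2 //; case: eqP => // e.
by case/eqP: nPQ; apply: arc_rep_inj.
Qed.

(** * Level classes of a functional on the arc *)

Section Line.
Variables (L : {vspace 'rV[F]_3}) (phi : {linear 'rV[F]_3 -> F^o}).
Hypothesis phiE : forall x, (phi x == 0) = (x \in L).

Definition level_class P := [set Q in K | phi (arc_rep Q) == phi (arc_rep P)].

Lemma level_classE P Q : P \in K -> Q \in K -> P != Q ->
  (Q \in level_class P) = (block_pt P Q <= L)%VS.
Proof.
move=> PK QK nPQ; rewrite inE QK /= arc_rep_addE // -memvE -phiE linearD.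
by rewrite addrC addr_eq0 oppr_pchar2.
Qed.

Lemma mem_level_class P : P \in K -> P \in level_class P.
Proof. by move=> PK; rewrite inE PK eqxx. Qed.

Lemma level_class_sub P Q : Q \in level_class P -> Q \in K.
Proof. by rewrite inE => /andP[]. Qed.

Lemma eq_level_class P Q : Q \in level_class P -> level_class Q = level_class P.
Proof. by rewrite inE => /andP[_ /eqP e]; apply/setP => R; rewrite !inE e. Qed.

(** [block_pt P] maps the class without [P] bijectively onto the points of [B] on [L]; the successor
    counts [P] itself. *)
Lemma card_level_class P : P \in K ->
  #|level_class P| = #|[set beta in B | (beta <= L)%VS]|.+1.
Proof.
move=> PK; rewrite (cardsD1 P) mem_level_class // add1n; congr _.+1.
rewrite -(@card_in_imset _ _ (block_pt P)); last first.
  apply: sub_in2 (block_pt_inj PK) => Q /setD1P[nQ /level_class_sub QK].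
  by rewrite !inE nQ.
apply: eq_card => beta; apply/imsetP/idP => [[Q /setD1P[nQ QP] ->] | ].
  have QK := level_class_sub QP; rewrite eq_sym in nQ.
  by rewrite inE -level_classE // QP andbT; have [] := block_ptP PK QK nQ.
rewrite inE => /andP[bB bL]; have [Q /andP[QK nQ] eb] := block_partner PK bB.
exists Q => //; rewrite in_setD1 nQ level_classE -?eb //.
by rewrite eq_sym.
Qed.

(** Two points lie in the same fibre of [Q + beta] exactly when they are equal or their secant
    passes through [beta]; each fibre is a pair inside the class. *)
Lemma card_level_class_even P beta : P \in K -> beta \in B -> (beta <= L)%VS ->
  ~~ odd #|level_class P|.
Proof.
move=> PK bB bL; rewrite -dvdn2.
apply: (dvdn_card_fibers (f := fun Q => (Q + beta)%VS)) => Q QP.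
have QK := level_class_sub QP.
have [R /andP[RK nRQ] eb] := block_partner QK bB.
have nQR : Q != R by rewrite eq_sym.
have [_ sQR] := block_ptP QK RK nQR; rewrite -eb in sQR.
have sRQ : (beta <= R + Q)%VS by rewrite addvC.
have RP : R \in level_class P.
  by rewrite -(eq_level_class QP) level_classE // -eb.
transitivity #|[set Q; R]|; last by rewrite cards2 nQR.
apply: eq_card => S; rewrite !inE; apply/idP/idP.
  rewrite (secant_blockE QK RK nQR bB sQR) => /andP[/andP[SK _] /eqP e].
  apply/idPn; rewrite negb_or => /andP[nSQ nSR].
  by have := arc_noncollinear QK RK SK nQR nSQ nSR; rewrite -e addvSl.
move: QP RP; rewrite !inE => QP RP /orP[] /eqP->; first by rewrite QP /=.
rewrite RP (secant_blockE QK RK nQR bB sQR).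
by rewrite (secant_blockE RK QK nRQ bB sRQ) addvC /=.
Qed.

End Line.

(** * Counting: k = 8 and classes of four points *)

Hypothesis nonlinearB : ~ collinear B.

Lemma nonlinear_two_points :
  exists beta gamma, [/\ beta \in B, gamma \in B & beta != gamma].
Proof.
case: (pickP [pred p : _ * _ | [&& p.1 \in B, p.2 \in B & p.1 != p.2]]).
  by case=> beta gamma /and3P[]; exists beta, gamma.
move=> none; case: nonlinearB.
(* The bound [<= 1] admits the zero subspace, which serves for an empty [B]. *)
have [beta db sB] : exists2 beta, (\dim beta <= 1)%N &
    forall gamma, gamma \in B -> gamma = beta.
  case: (set_0Vmem B) => [-> | [beta bB]].
    by exists 0%VS => [|gamma]; rewrite ?dimv0 // inE.
  exists beta => [|gamma gB]; first by have [->] := blocking_point bB.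
  by have := none (gamma, beta); rewrite /= gB bB => /negbFE/eqP.
have [|L dL sL] := @sub_dimv_eq _ _ 2 beta.
  by rewrite dimvf ltnS (leq_trans db).
by exists L; split=> // gamma /sB->.
Qed.

Lemma nonlinear_card_classes : (k <= 10)%N ->
  exists L (phi : {linear 'rV[F]_3 -> F^o}),
    [/\ \dim L = 2%N, forall x, (phi x == 0) = (x \in L), k = 8 &
        forall P, P \in K -> #|level_class phi P| = 4].
Proof.
move=> k10; have [beta [gamma [bB gB nbg]]] := nonlinear_two_points.
have [db _] := blocking_point bB; have [dg _] := blocking_point gB.
pose L := (beta + gamma)%VS.
have dL : \dim L = 2%N by rewrite dimv_add2.
have [|phi phiE] := @hyperplane_functional _ _ L; first by rewrite dL dimvf.
exists L, phi; pose M := [set delta in B | (delta <= L)%VS].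
have cl := card_level_class phiE.
have [P0 P0K] : exists P, P \in K.
  case: (set_0Vmem K) => [K0 | [P PK]]; last by exists P.
  case: arcK cardB => _ <- _; rewrite K0 cards0 => /eqP.
  by rewrite cards_eq0 => /eqP B0; rewrite B0 inE in bB.
have M2 : (2 <= #|M|)%N.
  apply: (@leq_trans #|[set beta; gamma]|); first by rewrite cards2 nbg.
  apply/subset_leq_card/subsetP => x.
  by rewrite !inE => /orP[] /eqP->; rewrite ?bB ?gB ?addvSl ?addvSr.
have Mev : ~~ odd #|M|.+1.
  rewrite -(cl _ P0K).
  exact: (card_level_class_even phiE P0K bB (addvSl _ _)).
have Mk : (#|M|.+1 %| k)%N.
  case: arcK => _ <- _.
  apply: (dvdn_card_fibers (f := fun P => phi (arc_rep P))) => P PK.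
  by rewrite -(cl _ PK).
have Mlt : (#|M| < k - 1)%N.
  rewrite -cardB; apply: proper_card; rewrite properE.
  apply/andP; split; first by apply/subsetP => x; rewrite inE => /andP[].
  apply/negP => /subsetP BM; apply: nonlinearB; exists L; split=> // delta.
  by move/BM; rewrite inE => /andP[].
suff [k8 M3] : k = 8 /\ #|M| = 3 by split=> // P PK; rewrite cl // -/M M3.
(* Cases on the quotient of k by [#|M|.+1], which is even and at least 4: [Mlt] excludes 0 and 1, 3
   or more would give k at least 12, and 2 leaves only 4 as divisor. *)
case/dvdnP: Mk => -[|[|[|d]]] ek; split; lia.
Qed.

(** * The two classes as a quadruple and its translate *)

Section TwoClasses.
Variables (L : {vspace 'rV[F]_3}) (phi : {linear 'rV[F]_3 -> F^o}).
Hypotheses (dimL : \dim L = 2%N) (phiE : forall x, (phi x == 0) = (x \in L)).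
Hypothesis card_class : forall P, P \in K -> #|level_class phi P| = 4.

(** The secant joining [c] to b_ab, a point of [L], meets [K] again in the same class. If it did so
    in [a] or [b], two secants through that point would share b_ab, so it does so in [d]. *)
Lemma class_partner P a b c d : P \in K ->
    level_class phi P = [set a; b; c; d] -> uniq [:: a; b; c; d] ->
  block_pt a b = block_pt c d.
Proof.
move=> PK eT /=; rewrite !inE !negb_or !andbT.
case/and3P=> /and3P[nab nac nad] /andP[nbc nbd] ncd.
have inT x : x \in [:: a; b; c; d] -> x \in level_class phi P.
  by rewrite eT !inE -!orbA.
have inK x : x \in [:: a; b; c; d] -> x \in K by move/inT/level_class_sub.
have aK : a \in K by rewrite inK ?mem_head.
have bK : b \in K by rewrite inK // !inE eqxx orbT.
have cK : c \in K by rewrite inK // !inE eqxx !orbT.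
have cT : c \in level_class phi P by rewrite inT // !inE eqxx !orbT.
have aT : level_class phi a = level_class phi P.
  by apply: eq_level_class; rewrite inT ?mem_head.
have [abB _] := block_ptP aK bK nab.
have [Q /andP[QK nQc] e] := block_partner cK abB.
rewrite e; congr block_pt.
have : Q \in level_class phi P.
  rewrite -(eq_level_class cT) (level_classE phiE) 1?eq_sym // -e.
  rewrite -(level_classE phiE) // aT inT //.
  by rewrite !inE eqxx orbT.
rewrite eT !inE (negPf nQc) orbF => /orP[/orP[] | ] /eqP eQ //; case/eqP: nQc.
  by case/eqP: nbc; apply: (block_ptI aK); rewrite // e eQ block_ptC.
case/eqP: nac; apply: (block_ptI bK); rewrite // 1?eq_sym //.
by rewrite block_ptC e eQ block_ptC.
Qed.

(** By [class_partner] the sum of the four representatives lies in b_ab = b_cd and in b_ac = b_bd.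
    These points are distinct, so the sum is zero. *)
Lemma class_sum0 P a b c d : P \in K ->
    level_class phi P = [set a; b; c; d] -> uniq [:: a; b; c; d] ->
  arc_rep d = arc_rep a + arc_rep b + arc_rep c.
Proof.
move=> PK eT uT.
have inK x : x \in [:: a; b; c; d] -> x \in K.
  by move=> xT; apply: (@level_class_sub phi P); rewrite eT; move: xT;
    rewrite !inE -!orbA.
have [aK bK cK dK] : [/\ a \in K, b \in K, c \in K & d \in K].
  by split; apply: inK; rewrite !inE eqxx ?orbT.
have e1 := class_partner PK eT uT.
have e2 : block_pt a c = block_pt b d.
  apply: (class_partner PK).
    by rewrite eT; congr (_ :|: _); rewrite setUAC.
  by move: uT; rewrite /= !inE !negb_or !andbT [c == b]eq_sym =>
    /and3P[/and3P[-> -> ->] /andP[-> ->] ->].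
move: uT; rewrite /= !inE !negb_or !andbT.
case/and3P=> /and3P[nab nac nad] /andP[nbc nbd] ncd.
have [abB _] := block_ptP aK bK nab; have [acB _] := block_ptP aK cK nac.
have [dab _] := blocking_point abB; have [dac _] := blocking_point acB.
pose s := arc_rep a + arc_rep b + arc_rep c + arc_rep d.
have s1 : s \in block_pt a b.
  by rewrite /s -addrA rpredD ?arc_rep_add // e1 arc_rep_add.
have s2 : s \in block_pt a c.
  by rewrite /s -addrA addrACA rpredD ?arc_rep_add // e2 arc_rep_add.
suff : s == 0 by rewrite addr_eq0 oppv_pchar2 // => /eqP.
apply: contraT => s0; case/eqP: nbc.
apply: (block_ptI aK) => //.
transitivity <[s]>%VS; first apply/esym; apply: dim1_sub_eq;
  by rewrite ?dim_vline ?s0 // -memvE.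
Qed.

Hypothesis k8 : k = 8.

(** For [R] other than [P], [S] is the second arc point on the line joining [R] to b_PQ; it changes
    class because b_PQ is off [L]. *)
Lemma class_translate P Q R : P \in K -> Q \in K ->
  Q \notin level_class phi P -> R \in level_class phi P ->
  exists2 S, S \in level_class phi Q &
    arc_rep S = arc_rep R + (arc_rep P + arc_rep Q).
Proof.
move=> PK QK nQ RP; have RK := level_class_sub RP.
have [-> | nRP] := eqVneq R P.
  exists Q; first exact: mem_level_class.
  by rewrite addrA -{2}[arc_rep P](oppv_pchar2 _ pchar2) subrr add0r.
have nPQ : P != Q by apply: contraNneq nQ => <-; apply: mem_level_class.
have [bB _] := block_ptP PK QK nPQ.
have [S /andP[SK nSR] e] := block_partner RK bB.
have nRS : R != S by rewrite eq_sym.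
have nL : ~~ (block_pt P Q <= L)%VS by rewrite -(level_classE phiE).
have SQ : S \in level_class phi Q.
  have disj : level_class phi P :&: level_class phi Q = set0.
    apply/setP => x; rewrite !inE; apply/negP.
    case/andP=> /andP[_ /eqP ex] /andP[_ /eqP ey]; case/negP: nQ.
    by rewrite inE QK -ey ex eqxx.
  (* Two disjoint classes of four exhaust the eight points of [K]. *)
  have : level_class phi P :|: level_class phi Q = K.
    apply/eqP; rewrite eqEcard; apply/andP; split.
      by apply/subsetP => x; rewrite inE => /orP[] /level_class_sub.
    by rewrite cardsU disj cards0 !card_class //; case: arcK => _ -> _;
      rewrite k8.
  move/setP/(_ S); rewrite SK in_setU => /orP[SP|//].
  by case/negP: nL; rewrite e -(level_classE phiE) // (eq_level_class RP).
exists S => //.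
have : arc_rep R + arc_rep S \in <[arc_rep P + arc_rep Q]>%VS.
  by rewrite -arc_rep_addE // e arc_rep_add.
case/vlineP=> t et.
have eR : phi (arc_rep R) = phi (arc_rep P)
  by move: RP; rewrite inE => /andP[_ /eqP].
have eS : phi (arc_rep S) = phi (arc_rep Q)
  by move: SQ; rewrite inE => /andP[_ /eqP].
(* [R] and [S] have the same [phi]-values as [P] and [Q], and [phi] is nonzero on b_PQ, so the
   factor [t] is 1. *)
have := congr1 phi et; rewrite linearZ linearD /= eR eS -linearD => /esym/eqP.
rewrite -subr_eq0 -{2}[phi _]scale1r -scalerBl scaler_eq0 phiE memvE.
rewrite -arc_rep_addE // (negPf nL) orbF subr_eq0 => /eqP t1.
move: et; rewrite t1 scale1r => <-; rewrite addrA.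
by rewrite -{2}[arc_rep R](oppv_pchar2 _ pchar2) subrr add0r.
Qed.

Lemma translated_classes P Q : P \in K -> Q \in K ->
  Q \notin level_class phi P ->
  K = level_class phi P :|:
      [set <[arc_rep R + (arc_rep P + arc_rep Q)]>%VS | R in level_class phi P].
Proof.
move=> PK QK nQ; apply/eqP; rewrite eq_sym eqEcard; apply/andP; split.
  apply/subsetP => x; rewrite inE => /orP[/level_class_sub //|/imsetP[R RP ->]].
  have [S /level_class_sub SK <-] := class_translate PK QK nQ RP.
  by rewrite -arc_repE.
rewrite cardsU (_ : _ :&: _ = set0) ?cards0.
  rewrite card_in_imset ?card_class //.
    by case: arcK => _ -> _; rewrite k8.
  move=> R R' RP RP'; have [S /level_class_sub SK eS] :=
    class_translate PK QK nQ RP.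
  have [S' /level_class_sub SK' eS'] := class_translate PK QK nQ RP'.
  rewrite -eS -eS' -!arc_repE // => eSS.
  apply: arc_rep_inj; rewrite ?(@level_class_sub phi P) //.
  by apply: (addIr (arc_rep P + arc_rep Q)); rewrite -eS -eS' eSS.
apply/setP => x; rewrite [RHS]inE; apply/negP => /setIP[xP /imsetP[R RP]].
have [S SQ <-] := class_translate PK QK nQ RP.
rewrite -arc_repE ?(level_class_sub SQ) // => ex; case/negP: nQ.
by rewrite -(eq_level_class xP) ex (eq_level_class SQ) mem_level_class.
Qed.

(** Otherwise the whole class of [P] would lie on [L], giving three collinear arc points. *)
Lemma arc_off_line P : P \in K -> phi (arc_rep P) != 0.
Proof.
move=> PK; apply/eqP => phiP.
have [a [b [c [d []]]]] := cards4P (card_class PK).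
rewrite /= !inE !negb_or !andbT => /and3P[/and3P[nab nac _] /andP[nbc _] _] eT.
have onL x : x \in level_class phi P -> x \in K /\ (x <= L)%VS.
  rewrite inE phiP => /andP[xK]; rewrite phiE => xL; split=> //.
  by rewrite (arc_repE xK) -memvE.
have [] := (onL a, onL b, onL c); rewrite eT !inE !eqxx ?orbT =>
  -[[]//aK aL [] // bK bL] [] // cK cL.
have := arc_noncollinear aK bK cK nab; rewrite ![c == _]eq_sym nac nbc =>
  /(_ isT isT).
by rewrite (addv_eq_line _ _ nab dimL aL bL) ?dim_arc ?cL.
Qed.

Lemma two_classes_equiv : exists lam a1 a2 : F,
  [/\ lam != 0, lam != 1,
      [set a1; a2; a1 + a2] :&: [set (0 : F); (1 : F); lam; lam + 1] = set0 &
      proj_equiv K (arc0 F :|: proj_image (homology lam a1 a2) (arc0 F))].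
Proof.
have cK : #|K| = 8 by case: arcK => _ -> _.
have [P PK] : exists P, P \in K by apply/set0Pn; rewrite -card_gt0 cK.
have [Q QK nQ] : exists2 Q, Q \in K & Q \notin level_class phi P.
  apply/subsetPn/negP => /subset_leq_card.
  by rewrite cK card_class.
have [a [b [c [e [uT eT]]]]] := cards4P (card_class PK).
have sum_e := class_sum0 PK eT uT.
have inT x : x \in [:: a; b; c; e] -> x \in level_class phi P.
  by rewrite eT !inE -!orbA.
have repT x : x \in [:: a; b; c; e] -> phi (arc_rep x) = phi (arc_rep P).
  by move/inT; rewrite inE => /andP[_ /eqP].
have inK x : x \in [:: a; b; c; e] -> x \in K by move/inT/level_class_sub.
have [aT bT cT] : [/\ a \in [:: a; b; c; e], b \in [:: a; b; c; e]
  & c \in [:: a; b; c; e]] by rewrite !inE !eqxx !orbT.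
have [[aK bK] cK'] := (inK a aT, inK b bT, inK c cT).
have [nab nac nbc] : [/\ a != b, a != c & b != c].
  move: uT; rewrite /= !inE !negb_or.
  by case/and3P=> /and3P[-> -> _] /andP[-> _].
have nPQ : phi (arc_rep P) != phi (arc_rep Q).
  by apply: contra nQ => e0; rewrite inE QK eq_sym.
apply: (@translated_quads_equiv F (arc_rep a) (arc_rep b) (arc_rep c)
  (arc_rep P + arc_rep Q) phi) => //.
(* With [c] moved to the front, freeness says that [c] is off the secant [a + b] and that [a] and
   [b] differ. *)
- have /perm_free -> := permEl (perm_catC [:: arc_rep a; arc_rep b]
                                          [:: arc_rep c]).
  rewrite free_cons span_cons span_seq1 free_cons span_seq1 seq1_free !memvE.
  rewrite -!arc_repE // arc_noncollinear ?(eq_sym c) //=; apply/andP; split.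
    by apply: contra nab => /(dim1_sub_eq (dim_arc aK) (dim_arc bK))->.
  by have := dim_arc bK; rewrite {1}(arc_repE bK) dim_vline; case: eqP.
- by rewrite !repT.
- by rewrite !repT.
- by rewrite linearD addr_eq0 oppr_pchar2.
- rewrite linearD (repT a) //= addrC -subr_eq0 addrK.
  exact: arc_off_line.
- have psE u :
      u \in [:: arc_rep a; arc_rep b; arc_rep c;
                arc_rep a + arc_rep b + arc_rep c] ->
    exists2 x, x \in level_class phi P & u = arc_rep x.
    rewrite -sum_e => uT'.
    have /mapP[x xT ->] : u \in map arc_rep [:: a; b; c; e] by [].
    by exists x => //; apply: inT.
  (* The translate of [z] represents an arc point [S] of the other class, hence off the secant of
     [x] and [y]. *)
  move=> _ _ _ /psE[x xP ->] /psE[y yP ->] /psE[z zP ->] nxy.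
  have [S SQ <-] := class_translate PK QK nQ zP.
  have nS t : t \in level_class phi P -> S != t.
    move=> tP; apply: contraNneq nQ => St.
    by rewrite -(eq_level_class tP) -St (eq_level_class SQ) mem_level_class.
  have [[xK yK] SK] := (level_class_sub xP, level_class_sub yP,
    level_class_sub SQ).
  rewrite memvE -!arc_repE // arc_noncollinear ?nS //.
  by apply: contraNneq nxy => ->.
rewrite {1}(translated_classes PK QK nQ) eT !imsetU !imset_set1 -sum_e.
by rewrite -!arc_repE // inK // !inE eqxx !orbT.
Qed.

End TwoClasses.

End MinimumBlockingSet.

Theorem theorem5p1 (F : finFieldType) (q_even : ~~ odd #|F|)
    (k : nat) (K : {set {vspace 'rV[F]_3}})
    (arcK : is_arc k K) (k_le10 : (k <= 10)%N)
    (nonlinear_minimum_blocking_set :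
      exists B : {set {vspace 'rV[F]_3}},
        [/\ blocks_secants K B, #|B| = (k - 1)%N & ~ collinear B]) :
  k = 8%N /\
  exists lam a1 a2 : F,
    [/\ lam != 0, lam != 1,
        [set a1; a2; a1 + a2] :&: [set (0 : F); (1 : F); lam; lam + 1] = set0 &
        proj_equiv K (arc0 F :|: proj_image (homology lam a1 a2) (arc0 F))].
Proof.
have F2 := even_pchar2 q_even.
have [B [blockB cardB nonlinearB]] := nonlinear_minimum_blocking_set.
have [L [phi [dimL phiE k8 card_class]]] :=
  nonlinear_card_classes arcK blockB cardB F2 nonlinearB k_le10.
by split=> //; apply: (two_classes_equiv arcK blockB cardB F2 dimL phiE
  card_class k8).
Qed.
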